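(* Let $z\in(0,1)$ and consider the stochastic approximation recursion of the context with step sizes $\alpha_k=\alpha/(k+h)^z$. In general, the following hold. (1) For any $\beta'<2-z$, there do not exist constants $K_1',K_2'>0$ such that $$\mathbb P\left(\|x_k-x^*\|_c^2\le\frac{K_1'\log\left(\frac{K_2'}\delta\right)^{\beta'}}{(k+h)^z}\right)\ge1-\delta\qquad\forall\,\delta\in(0,1),\ k\ge0.$$ (2) For any $\beta'<1-z$, there do not exist constants $K_1',K_2'>0$ such that $$\mathbb P\left(\|x_k-x^*\|_c^2\le\frac{K_1'\exp\left(K_2'\log\left(\frac1\delta\right)^{\beta'}\right)}{(k+h)^z}\right)\ge1-\delta\qquad\forall\,\delta\in(0,1),\ k\ge0.$$
   Context: ''In general'' means that such bounds cannot be guaranteed under the assumptions (A1)–(A5) below alone; it is not asserted that they fail for every recursion satisfying these assumptions. Setting. $(S_k)_{k\ge0}$ is a time-homogeneous ergodic Markov chain on a finite set $\mathcal S$ with transition matrix $P$ and unique stationary distribution $\pi$ (i.i.d. sequences are a special case); $(Z_k)_{k\ge0}$ is a sequence of random vectors in $\mathbb R^d$ independent of $(S_k)$; $F:\mathbb R^d\times\mathcal S\to\mathbb R^d$; step sizes are $\alpha_k=\alpha/(k+h)^z$ with $\alpha,h>0$; $x_0\in\mathbb R^d$ is deterministic and $x_{k+1}=x_k+\alpha_k(F(x_k,S_k)+Z_k-x_k)$. Let $\bar F(x)=\mathbb E[F(x,S)]$, $S\sim\pi$. For each $x$, $V_x:\mathcal S\to\mathbb R^d$ is a solution of Poisson's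 equation $F(x,s)-\bar F(x)+\sum_{s'}P(s,s')V_x(s')=V_x(s)$ for all $s\in\mathcal S$. $\|\cdot\|_c$ is a norm on $\mathbb R^d$; $\mathcal F_k=\sigma(S_0,Z_0,\dots,S_{k-1},Z_{k-1})$; $a\wedge b=\min\{a,b\}$. (A1) There is a unique $x^*$ with $\bar F(x^* )=x^*$; there are constants $A_3,B_3\ge0$ with $\|\bar F(x)-x^*\|_c\le A_3\|x-x^*\|_c+B_3$ for all $x$; there are constants $L_1,L_2\ge0$ with $\|V_{x_2}(s)-V_{x_1}(s)\|_c\le L_1\|x_2-x_1\|_c$ and $\|V_{x^*}(s)\|_c\le L_2$ for all $x_1,x_2,s$. (A2) There are $A_1,B_1\ge0$ with $\|F(x,s)-\bar F(x)\|_c\le A_1\|x\|_c+B_1$ for all $x,s$. (A3) $\mathbb E[Z_k\mid\mathcal F_k]=0$ for all $k\ge 0$, and there is $B_2\ge0$ with $\|Z_k\|_c\le B_2$ a.s. for all $k$. (A4) There are a (Lyapunov) function $M:\mathbb R^d\to\mathbb R$, a norm $\|\cdot\|_s$, and constants $\eta,L_s,l,u>0$ such that for all $x,y$: $\langle\nabla M(x-x^* ),\bar F(x)-x\rangle\le-\eta M(x-x^* )$; $M(y)\le M(x)+\langle\nabla M(x),y-x\rangle+\frac{L_s}2\|x-y\|_s^2$; $lM(x)\le\|x\|_c^2\le uM(x)$; $\nabla M(0)=0$. (A5) (for $z\in(0,1)$) $\alpha>0$, $h\ge(4z/(\alpha\eta))^{1/(1-z)}$ and $h\ge\max\left\{\frac{4C_1}{\eta\alpha},\frac{\eta}{2\alpha},\frac{uL_s(L_1+L_2)}{\ell_{cs}^2\alpha},8\right\}$,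 where $\ell_{cs},u_{cs}$ satisfy $\ell_{cs}\|x\|_s\le\|x\|_c\le u_{cs}\|x\|_s$ for all $x$, $A_{13}=A_1+A_3$, $B_{123}=B_1+B_2+B_3$, $C_1'=A_{13}(L_1+L_2)+2(L_1+L_2)+L_1(A_1\|x^*\|_c+B_{123})$ and $C_1=\frac{uL_s}{\ell_{cs}^2(\ell_{cs}\wedge1)^2}\left((\frac3\alpha+\eta)(L_1+L_2)+(3L_1+1)(1+A_{13})^2+C_1'\right)+\frac{uL_s(1+A_{13})^2}{\ell_{cs}^2}$. *)

(* Defs.v *)
From HB Require Import structures.
From mathcomp Require Import all_boot all_order all_algebra.
From mathcomp Require Import all_classical all_reals all_analysis.
Set Implicit Arguments.
Unset Strict Implicit.
Unset Printing Implicit Defensive.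
Import Order.TTheory GRing.Theory Num.Theory.
Import numFieldNormedType.Exports.
Local Open Scope classical_set_scope.
Local Open Scope ring_scope.

(* The ambient topology on 'rV[R]_d is that of the library's sup norm; since all
   norms on R^d are equivalent, open sets, Borel sets and differentiability do
   not depend on the norms N introduced below. *)
Definition is_norm (R : realType) (d : nat) (N : 'rV[R]_d -> R) : Prop :=
  [/\ forall x y, N (x + y) <= N x + N y,
      forall (a : R) x, N (a *: x) = `|a| * N x
    & forall x, N x = 0 -> x = 0].

Definition dotp (R : realType) (d : nat) (u v : 'rV[R]_d) : R :=
  \sum_(i < d) u 0 i * v 0 i.

Definition grad (R : realType) (d : nat) (M : 'rV[R]_d -> R) (x : 'rV[R]_d) :
    'rV[R]_d :=
  \row_(i < d) 'D_(delta_mx 0 i) M x.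

Definition borel_map (R : realType) (d : nat) (f : 'rV[R]_d -> 'rV[R]_d) : Prop :=
  forall U : set 'rV[R]_d, open U -> <<s @open 'rV[R]_d >> (f @^-1` U).

Fixpoint nstep (R : realType) (T : finType) (P : T -> T -> R) (n : nat)
    (s t : T) : R :=
  if n is m.+1 then \sum_(r : T) P s r * nstep P m r t else (s == t)%:R.

Definition is_distribution (R : realType) (T : finType) (p : T -> R) : Prop :=
  (forall s, 0 <= p s) /\ \sum_(s : T) p s = 1.

Definition stationary (R : realType) (T : finType) (P : T -> T -> R)
    (p : T -> R) : Prop :=
  is_distribution p /\ forall t, \sum_(s : T) p s * P s t = p t.

Definition irreducible_chain (R : realType) (T : finType) (P : T -> T -> R) : Prop :=
  forall s t, exists n, 0 < nstep P n s t.

(* The gcd of the return times of every state is 1. *)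
Definition aperiodic_chain (R : realType) (T : finType) (P : T -> T -> R) : Prop :=
  forall s (g : nat),
    (forall n, (0 < n)%N -> 0 < nstep P n s s -> (g %| n)%N) -> g = 1%N.

Definition ergodic_chain (R : realType) (T : finType) (P : T -> T -> R) : Prop :=
  [/\ forall s, is_distribution (P s), irreducible_chain P & aperiodic_chain P].

Definition random_vector (R : realType) (disp : measure_display)
    (Omega : measurableType disp) (d : nat) (X : Omega -> 'rV[R]_d) : Prop :=
  forall U : set 'rV[R]_d, open U -> measurable (X @^-1` U).

(* (S_k) is a Markov chain with transition matrix P and arbitrary initial law;
   the second clause is the Markov property multiplied out, so that no
   conditioning on null events is needed. *)
Definition markov_chain (R : realType) (disp : measure_display)
    (Omega : measurableType disp) (Pr : probability Omega R) (T : finType)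
    (P : T -> T -> R) (S : nat -> Omega -> T) : Prop :=
  (forall k s, measurable (S k @^-1` [set s])) /\
  (forall k (s : nat -> T),
     Pr [set w | forall j, (j <= k.+1)%N -> S j w = s j] =
     (Pr [set w | forall j, (j <= k)%N -> S j w = s j] * (P (s k) (s k.+1))%:E)%E).

Definition state_events (Omega : Type) (T : finType) (S : nat -> Omega -> T)
    (J : set nat) : set (set Omega) :=
  [set A | exists2 j, J j & exists s, A = S j @^-1` [set s]].

Definition noise_events (R : realType) (Omega : Type) (d : nat)
    (Z : nat -> Omega -> 'rV[R]_d) (J : set nat) : set (set Omega) :=
  [set A | exists2 j, J j & exists2 U, open U & A = Z j @^-1` U].

Definition independent_processes (R : realType) (disp : measure_display)
    (Omega : measurableType disp) (Pr : probability Omega R) (T : finType) (d : nat)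
    (S : nat -> Omega -> T) (Z : nat -> Omega -> 'rV[R]_d) : Prop :=
  forall A B, <<s state_events S setT >> A -> <<s noise_events Z setT >> B ->
    Pr (A `&` B) = (Pr A * Pr B)%E.

Definition filtration (R : realType) (Omega : Type) (T : finType) (d : nat)
    (S : nat -> Omega -> T) (Z : nat -> Omega -> 'rV[R]_d) (k : nat) :
    set (set Omega) :=
  <<s state_events S [set j | (j < k)%N] `|` noise_events Z [set j | (j < k)%N] >>.

(* Y is a version of E[X | G] *)
Definition is_cond_expectation (R : realType) (disp : measure_display)
    (Omega : measurableType disp) (Pr : probability Omega R)
    (G : set (set Omega)) (X Y : Omega -> R) : Prop :=
  [/\ Pr.-integrable setT (EFin \o X), Pr.-integrable setT (EFin \o Y),
      forall B : set R, measurable B -> G (Y @^-1` B)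
    & forall A, G A ->
        (\int[Pr]_(w in A) (Y w)%:E = \int[Pr]_(w in A) (X w)%:E)%E].

Record sa_recursion (R : realType) := SARecursion {
  disp : measure_display;
  Omega : measurableType disp;
  Pr : probability Omega R;
  dim : nat;
  state : finType;
  trans : state -> state -> R;
  statdist : state -> R;
  schain : nat -> Omega -> state;
  noise : nat -> Omega -> 'rV[R]_dim;
  opF : 'rV[R]_dim -> state -> 'rV[R]_dim;
  poisson : 'rV[R]_dim -> state -> 'rV[R]_dim; (* V_x(s) *)
  normc : 'rV[R]_dim -> R;
  xinit : 'rV[R]_dim;
  xstar : 'rV[R]_dim;
  alpha : R;
  hshift : R }.

Definition stepsize (R : realType) (m : sa_recursion R) (z : R) (k : nat) : R :=
  alpha m / (k%:R + hshift m) `^ z.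

Fixpoint iterate (R : realType) (m : sa_recursion R) (z : R) (k : nat)
    (w : Omega m) : 'rV[R]_(dim m) :=
  if k is j.+1 then
    iterate z j w + stepsize m z j *:
      (opF (iterate z j w) (schain j w) + noise j w - iterate z j w)
  else xinit m.

Definition opFbar (R : realType) (m : sa_recursion R) (x : 'rV[R]_(dim m)) :
    'rV[R]_(dim m) :=
  \sum_(s : state m) statdist s *: opF x s.

Record sa_setting (R : realType) (m : sa_recursion R) : Prop := SASetting {
  dim_gt0 : (0 < dim m)%N;
  trans_ergodic : ergodic_chain (@trans R m);
  statdist_stationary : stationary (@trans R m) (@statdist R m);
  statdist_unique : forall p, stationary (@trans R m) p -> p = @statdist R m;
  schain_markov : markov_chain (Pr m) (@trans R m) (@schain R m);
  noise_random : forall k, random_vector (@noise R m k);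
  schain_noise_indep :
    independent_processes (Pr m) (@schain R m) (@noise R m);
  opF_borel : forall s, borel_map (fun x => @opF R m x s);
  poissonE : forall x s,
    opF x s - opFbar x + \sum_(t : state m) trans s t *: poisson x t
      = poisson x s;
  normc_norm : is_norm (@normc R m);
  alpha_gt0 : 0 < alpha m;
  hshift_gt0 : 0 < hshift m }.

Record sa_constants (R : realType) := SAConstants {
  cA1 : R; cB1 : R; cB2 : R; cA3 : R; cB3 : R; cL1 : R; cL2 : R }.

Record sa_lyapunov (R : realType) (d : nat) := SALyapunov {
  lyap : 'rV[R]_d -> R;
  norms : 'rV[R]_d -> R;
  eta : R; Ls : R; lowc : R; upc : R; ellcs : R; ucs : R }.

Definition fixpoint_and_poisson_bounds (R : realType) (m : sa_recursion R)
    (c : sa_constants R) : Prop :=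
  [/\ opFbar (xstar m) = xstar m /\ (forall y, opFbar y = y -> y = xstar m),
      [/\ 0 <= cA3 c, 0 <= cB3 c, 0 <= cL1 c & 0 <= cL2 c],
      forall x, normc (opFbar x - xstar m) <= cA3 c * normc (x - xstar m) + cB3 c,
      forall x1 x2 s,
        normc (@poisson R m x2 s - poisson x1 s) <= cL1 c * normc (x2 - x1)
    & forall s, normc (poisson (xstar m) s) <= cL2 c].

Definition markov_noise_growth (R : realType) (m : sa_recursion R)
    (c : sa_constants R) : Prop :=
  [/\ 0 <= cA1 c, 0 <= cB1 c
    & forall x s, normc (@opF R m x s - opFbar x) <= cA1 c * normc x + cB1 c].

Definition bounded_martingale_noise (R : realType) (m : sa_recursion R)
    (c : sa_constants R) : Prop :=
  [/\ 0 <= cB2 c,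
      forall k i, is_cond_expectation (Pr m)
        (filtration (@schain R m) (@noise R m) k)
        (fun w => noise k w 0 i) (fun=> 0)
    & forall k, {ae Pr m, forall w, normc (noise k w) <= cB2 c}].

Definition lyapunov_condition (R : realType) (m : sa_recursion R)
    (L : sa_lyapunov R (dim m)) : Prop :=
  [/\ is_norm (norms L) /\ [/\ 0 < eta L, 0 < Ls L, 0 < lowc L & 0 < upc L],
      (forall x, differentiable (lyap L) x) /\ grad (lyap L) 0 = 0,
      forall x, dotp (grad (lyap L) (x - xstar m)) (opFbar x - x)
                <= - eta L * lyap L (x - xstar m),
      forall x y, lyap L y <= lyap L x + dotp (grad (lyap L) x) (y - x)
                              + Ls L / 2 * norms L (x - y) ^+ 2
    & forall x, lowc L * lyap L x <= normc x ^+ 2 /\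
                normc x ^+ 2 <= upc L * lyap L x].

Definition cA13 (R : realType) (c : sa_constants R) : R := cA1 c + cA3 c.

Definition cB123 (R : realType) (c : sa_constants R) : R :=
  cB1 c + cB2 c + cB3 c.

Definition constC1' (R : realType) (m : sa_recursion R) (c : sa_constants R) : R :=
  cA13 c * (cL1 c + cL2 c) + 2 * (cL1 c + cL2 c)
  + cL1 c * (cA1 c * normc (xstar m) + cB123 c).

Definition constC1 (R : realType) (m : sa_recursion R) (c : sa_constants R)
    (L : sa_lyapunov R (dim m)) : R :=
  upc L * Ls L / (ellcs L ^+ 2 * Num.min (ellcs L) 1 ^+ 2)
    * ((3 / alpha m + eta L) * (cL1 c + cL2 c)
       + (3 * cL1 c + 1) * (1 + cA13 c) ^+ 2 + constC1' m c)
  + upc L * Ls L * (1 + cA13 c) ^+ 2 / ellcs L ^+ 2.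

Definition stepsize_condition (R : realType) (m : sa_recursion R) (z : R)
    (c : sa_constants R) (L : sa_lyapunov R (dim m)) : Prop :=
  [/\ 0 < alpha m,
      [/\ 0 < ellcs L, 0 < ucs L
        & forall x, ellcs L * norms L x <= normc x /\
                    normc x <= ucs L * norms L x],
      (4 * z / (alpha m * eta L)) `^ (1 / (1 - z)) <= hshift m
    & Num.max (4 * constC1 c L / (eta L * alpha m))
       (Num.max (eta L / (2 * alpha m))
         (Num.max
            (upc L * Ls L * (cL1 c + cL2 c) / (ellcs L ^+ 2 * alpha m)) 8))
      <= hshift m].

Definition sa_assumptions (R : realType) (z : R) (m : sa_recursion R) : Prop :=
  exists (c : sa_constants R) (L : sa_lyapunov R (dim m)),
    [/\ fixpoint_and_poisson_bounds m c, markov_noise_growth m c,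
        bounded_martingale_noise m c, lyapunov_condition L
      & stepsize_condition z c L].

(* Main.v *)
Require Import Defs.
From HB Require Import structures.
From mathcomp Require Import all_boot all_order all_algebra.
From mathcomp Require Import all_classical all_reals all_analysis.
From mathcomp Require Import ring lra zify.
Import Order.TTheory GRing.Theory Num.Theory.
Import numFieldNormedType.Exports.
Local Open Scope classical_set_scope.
Local Open Scope ring_scope.

(** One recursion on the real line defeats both families of bounds. Let the
    chain be a sequence of fair coin flips, let there be no additive noise, and
    put F(x, heads) = 2x, F(x, tails) = -2x, so that Fbar = 0 and x* = 0. With
    M(x) = x^2 the mean field is perfectly contracting, yet on the event that
    the first k flips are all heads every step multiplies the iterate by
    1 + alpha_j. This event has probability 2^-k, and on it
    x_k >= (1 + (k + h)^-z)^k, so that x_k^2 is at least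
    exp(k / (k + h)^z), an exponential in a constant times k^(1-z)
    ([iterate_heads_ge]).

    Suppose that x_k^2 <= g(delta) / (k + h)^z held with probability at least
    1 - delta for all delta and k. Taking delta = 2^-(k+1), half the probability
    of the bad event, forces g(2^-(k+1)) >= exp(k / (k + h)^z)
    ([tail_bound_ge]). Since log(1/delta) is of order k, the function g must grow
    at least like exp(c log(1/delta)^(1-z)) along this sequence
    ([no_subexponential_tail]). A function exp(K2 log(1/delta)^beta) with
    beta < 1 - z does not, whence the second part. No power of log(1/delta) does
    either, because a power K v^q is exp(log K + q log v) and the logarithm is
    dominated by v^((1-z)/2); this gives the first part, for every beta.

    The probability space is [0, 1[ with Lebesgue measure and the flips are the
    binary digits: prescribing the first k digits selects a dyadic interval of
    length 2^-k ([coin_flips]), which contains the Markov property. *)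

(** * Fair coin flips as binary digits *)

Lemma truncn_double {R : realType} (y : R) : 0 <= y ->
  (Num.truncn (2 * y))./2 = Num.truncn y.
Proof.
move=> y0; apply/esym/truncn_def.
have /truncn_itv/andP[] : 0 <= 2 * y by rewrite mulr_ge0.
set t := Num.truncn _ => lo hi.
have h1 : (t./2.*2%:R : R) <= t%:R by rewrite ler_nat; lia.
have h2 : (t.+1%:R : R) <= (t./2.+1).*2%:R by rewrite ler_nat; lia.
rewrite -!mul2n !natrM in h1 h2.
by apply/andP; split; lra.
Qed.

Definition dyadic {R : realType} (k : nat) (w : R) : nat :=
  Num.truncn (2 ^+ k * w).

Definition flip {R : realType} (k : nat) (w : R) : bool := odd (dyadic k.+1 w).

Fixpoint digits_value (s : nat -> bool) (k : nat) : nat :=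
  if k is j.+1 then (s j + (digits_value s j).*2)%N else 0%N.

Lemma digits_value_lt s k : (digits_value s k < 2 ^ k)%N.
Proof. by elim: k => //= k IH; rewrite expnS; case: (s k); lia. Qed.

(** Doubling 2^k w appends one binary digit to its integer part, so the first k
    digits of w are recovered from the integer part of 2^k w by repeated halving
    ([truncn_double]). *)
Lemma flips_dyadic {R : realType} (s : nat -> bool) (k : nat) (w : R) :
  0 <= w -> w < 1 ->
  (forall j, (j < k)%N -> flip j w = s j) <-> dyadic k w = digits_value s k.
Proof.
move=> w0 w1; elim: k => [|k IH].
  split=> // _; rewrite /dyadic expr0 mul1r.
  by apply: truncn_def; rewrite w0.
have half : (dyadic k.+1 w)./2 = dyadic k w.
  by rewrite /dyadic exprS -mulrA truncn_double// mulr_ge0// exprn_ge0.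
split=> [H|E] /=.
  rewrite -(IH.1 (fun j jk => H j (ltnW jk))) -half -(H k (ltnSn k)).
  by rewrite odd_double_half.
have /= Eb : dyadic k.+1 w = (s k + (digits_value s k).*2)%N := E.
move=> j; rewrite ltnS leq_eqVlt => /orP[/eqP->|jk].
  by rewrite /flip Eb oddD odd_double addbF; case: (s k).
by apply: (IH.2 _ j jk); rewrite -half Eb half_bit_double.
Qed.

Lemma measurable_dyadic {R : realType} (k n : nat) :
  measurable [set w : R | dyadic k w = n].
Proof.
have p2 : 0 < (2 : R) ^+ k by rewrite exprn_gt0.
have ge m : measurable [set w : R | m%:R <= 2 ^+ k * w].
  rewrite (_ : [set w | _] = `[m%:R / 2 ^+ k, +oo[%classic) //.
  by apply/seteqP; split=> w; rewrite /= in_itv/= andbT ler_pdivrMr// mulrC.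
have gt m : measurable [set w : R | (m < dyadic k w)%N].
  rewrite (_ : [set w | _] = [set w : R | m.+1%:R <= 2 ^+ k * w]) //.
  by apply/seteqP; split=> w; rewrite /= truncn_gt_nat.
case: n => [|n].
  rewrite (_ : [set w | _] = ~` [set w : R | (0 < dyadic k w)%N]); last first.
    by apply/seteqP; split=> w /=; [move=> ->|move/negP; rewrite -eqn0Ngt => /eqP].
  exact: measurableC.
rewrite (_ : [set w | _] =
  [set w : R | (n < dyadic k w)%N] `\` [set w : R | (n.+1 < dyadic k w)%N]).
  exact: measurableD.
by apply/seteqP; split=> w /=; [move=> ->; split; lia|move=> [? ?]; lia].
Qed.

Lemma measurable_flip {R : realType} (k : nat) (b : bool) :
  measurable (flip k @^-1` [set b] : set R).
Proof.
rewrite (_ : _ @^-1` _ =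
  \bigcup_(n in [set n | odd n = b]) [set w : R | dyadic k.+1 w = n]).
  by apply: bigcup_measurable => n _; exact: measurable_dyadic.
apply/seteqP; split=> w /=; first by move=> <-; exists (dyadic k.+1 w).
by move=> [n <- <-].
Qed.

(** Lebesgue measure on the half-open unit interval, viewed as a probability on
    the whole line; leaving out the point 1 makes the correspondence between
    digit prefixes and dyadic intervals exact. *)
Definition coin (R : realType) : set (measurableTypeR R) -> \bar R :=
  mrestr (@lebesgue_measure R) (measurable_itv `[0, 1[).

HB.instance Definition _ (R : realType) := Measure.copy (coin R)
  (mrestr (@lebesgue_measure R) (measurable_itv `[0, 1[)).

Lemma coin_setT (R : realType) : coin R setT = 1%E.
Proof.
by rewrite /coin /mrestr setTI lebesgue_measure_itv/= lte01 oppr0 adde0.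
Qed.

HB.instance Definition _ (R : realType) :=
  Measure_isProbability.Build _ _ _ (coin R) (coin_setT R).

(** Every prescription of the first k flips is a dyadic interval of length 2^-k;
    both the Markov property and the rarity of long runs of heads follow. *)
Lemma coin_flips {R : realType} (s : nat -> bool) (k : nat) :
  coin R [set w | forall j, (j < k)%N -> flip j w = s j] = (2 ^- k)%:E.
Proof.
have p2 : 0 < (2 : R) ^+ k by rewrite exprn_gt0.
rewrite /coin /mrestr.
rewrite (_ : _ `&` _ =
  `[(digits_value s k)%:R / 2 ^+ k, (digits_value s k).+1%:R / 2 ^+ k[%classic).
  rewrite lebesgue_measure_itv/= lte_fin ltr_pM2r ?invr_gt0// ltr_nat ltnSn.
  by rewrite -EFinB -mulrBl -natr1 addrAC subrr add0r mul1r.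
apply/seteqP; split=> w /=; rewrite !in_itv/= ler_pdivrMr// ltr_pdivlMr// mulrC.
  move=> [H /andP[w0 w1]]; have /(flips_dyadic s k w w0 w1) <- := H.
  by apply: truncn_itv; rewrite mulr_ge0// ltW.
move=> /andP[lo hi].
have w0 : 0 <= w by rewrite -(pmulr_rge0 _ p2) (le_trans _ lo).
have w1 : w < 1.
  rewrite -(ltr_pM2l p2) mulr1 (lt_le_trans hi)// -natrX ler_nat.
  exact: digits_value_lt.
split; last by rewrite w0 w1.
by apply/flips_dyadic => //; apply: truncn_def; rewrite lo hi.
Qed.

(** * The recursion and its assumptions *)

Definition signed_double {R : realType} (x : 'rV[R]_1) (b : bool) : 'rV[R]_1 :=
  (if b then 2 else -2) *: x.

(** Since F averages to 0 under the coin, V_x(s) = F(x, s) solves Poisson's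
    equation, and both arguments of the structure are the same function. *)
Definition coin_model (R : realType) (h : R) : sa_recursion R :=
  @SARecursion R _ (measurableTypeR R) (coin R) 1 bool (fun _ _ => 2^-1)
    (fun=> 2^-1) flip (fun _ _ => 0) signed_double signed_double
    (fun x => `|x 0 0|) (const_mx 1) 0 1 h.

Lemma opFbar_coin_model (R : realType) (h : R) x :
  @opFbar R (coin_model R h) x = 0.
Proof.
by rewrite /opFbar /= big_bool /signed_double/= !scalerA -scalerDl mulrN subrr
  scale0r.
Qed.

Lemma abs_coord_norm (R : realType) :
  is_norm (fun x : 'rV[R]_1 => `|x 0 0|).
Proof.
split=> [x y|a x|x /eqP]; first by rewrite mxE ler_normD.
  by rewrite mxE normrM.
rewrite normr_eq0 => /eqP x0; apply/rowP => i; rewrite ord1 mxE; exact: x0.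
Qed.

Lemma norm_signed_double (R : realType) (x : 'rV[R]_1) b :
  `|signed_double x b 0 0| = 2 * `|x 0 0|.
Proof. rewrite mxE normrM; case: b; by rewrite ?normrN normr_nat. Qed.

(** The null noise generates only the trivial sigma-algebra, which is what makes
    it independent of the chain. *)
Lemma sigma_noise0 (R : realType) (Omega : Type) (d : nat) (J : set nat) B :
  <<s noise_events (fun (_ : nat) (_ : Omega) => 0 : 'rV[R]_d) J >> B ->
  B = set0 \/ B = setT.
Proof.
apply: (smallest_sub (X := [set B | B = set0 \/ B = setT])) => [|A].
  split=> [|A|A AE]; first by left.
    by rewrite setTD => -[]->; rewrite ?setC0 ?setCT; [right|left].
  have [[n An]|H] := pselect (exists n, A n = setT).
    by right; apply/seteqP; split=> // w _; exists n => //; rewrite An.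
  left; apply/seteqP; split=> // w [n _].
  by case: (AE n) => [->//|An]; case: H; exists n.
move=> [j _ [U _ ->]]; rewrite (preimage_cst (0 : 'rV[R]_d) U).
by case: ifP; [right|left].
Qed.

Lemma setting_coin_model (R : realType) (h : R) : 0 < h ->
  sa_setting (coin_model R h).
Proof.
move=> h0; split=> //=.
- split=> [s|s t|s g /(_ 1%N isT)].
  + split=> [t|]; first by rewrite invr_ge0.
    by rewrite big_bool/=; field.
  + exists 1%N; rewrite /= big_bool/=; case: t; rewrite ?mulr0 ?mulr1; lra.
  + rewrite /= => H; apply/eqP; rewrite -dvdn1; apply: H.
    by rewrite big_bool; case: s => /=; lra.
- split; last by move=> t; rewrite big_bool/=; field.
  split=> [s|]; first by rewrite invr_ge0.
  by rewrite big_bool/=; field.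
- move=> p [[_ p1] pE]; apply/funext => t.
  by rewrite -(pE t) -mulr_suml p1 mul1r.
- split=> [k s|k s]; first exact: measurable_flip.
  have := coin_flips (R := R) s k.+2; have := coin_flips (R := R) s k.+1.
  move=> E1 E2; apply: (etrans E2); rewrite [X in (X * _)%E]E1 -EFinM.
  by rewrite [in LHS]exprSr invfM mulrC.
- move=> k U _; rewrite (preimage_cst (0 : 'rV[R]_1) U).
  by case: ifP => _; [exact: measurableT|exact: measurable0].
- move=> A B _ /sigma_noise0[->|->].
    by rewrite setI0 measure0 mule0.
  by rewrite setIT probability_setT mule1.
- move=> s U oU; apply: sub_gen_smallest.
  by apply: open_comp => // x _; exact: scaler_continuous.
- move=> x s.
  rewrite opFbar_coin_model subr0 big_bool/= !scalerA -scalerDl.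
  by rewrite mulrN subrr scale0r addr0.
- exact: abs_coord_norm.
Qed.

Definition coin_constants (R : realType) : sa_constants R :=
  SAConstants 2 0 0 0 0 2 0.

Definition coin_lyapunov (R : realType) : sa_lyapunov R 1 :=
  SALyapunov (fun x => x 0 0 ^+ 2) (fun x => `|x 0 0|) 2 2 1 1 1 1.

#[local] Instance is_diff_sqr_coord (R : realType) (x : 'rV[R]_1) :
  is_diff x (fun y : 'rV[R]_1 => y 0 0 ^+ 2) (fun v => 2 * x 0 0 * v 0 0).
Proof.
pose c (y : 'rV[R]_1) : R := y 0 0.
have c_lin : linear c by move=> k y y'; rewrite /c !mxE.
pose cM := GRing.isLinear.Build _ _ _ _ _ c_lin.
pose cL : {linear _ -> _} := HB.pack c cM.
have c_diff : is_diff x c c.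
  apply: DiffDef; first exact: differentiable_coord.
  exact: (@diff_lin _ _ _ cL _ (@coord_continuous _ _ _ _ _)).
have -> : (fun y : 'rV[R]_1 => y 0 0 ^+ 2) = c ^+ 2 by [].
by apply: is_diff_eq; apply/funext => v; rewrite /= expr1.
Qed.

Lemma grad_sqr_coord (R : realType) (x : 'rV[R]_1) :
  grad (fun y : 'rV[R]_1 => y 0 0 ^+ 2) x = 2 *: x.
Proof.
apply/rowP => i; rewrite ord1 !mxE deriveE; last exact: ex_diff.
by rewrite diff_val mxE !eqxx mulr1.
Qed.

(** With the chosen constants C_1' = 8 and C_1 = 180, so the largest of the four
    explicit lower bounds on h is 4 C_1 / (eta alpha) = 360. *)
Lemma assumptions_coin_model (R : realType) (z h : R) :
  (4 * z / (1 * 2)) `^ (1 / (1 - z)) <= h -> 360 <= h ->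
  sa_assumptions z (coin_model R h).
Proof.
move=> h1 h2; exists (coin_constants R), (coin_lyapunov R); split.
- split=> /=.
  + by split=> [|y]; rewrite opFbar_coin_model.
  + by rewrite !ler0n.
  + by move=> x; rewrite opFbar_coin_model subr0 mxE normr0 mul0r addr0.
  + by move=> x1 x2 s; rewrite -scalerBr norm_signed_double.
  + by move=> s; rewrite norm_signed_double mxE normr0 mulr0.
- split=> //= x s.
  by rewrite opFbar_coin_model subr0 norm_signed_double addr0.
- split=> //= [k i|k]; last by apply: aeW => w; rewrite mxE normr0.
  rewrite (_ : (fun w => _) = fun=> 0); last by apply/funext => w; rewrite mxE.
  split=> //; [exact: integrable0|exact: integrable0|].
  move=> B _; rewrite preimage_cst.
  have [G0 GC _] : sigma_algebra setT (filtration (@flip R)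
      (fun (_ : nat) (_ : R) => 0 : 'rV[R]_1) k) by exact: smallest_sigma_algebra.
  by case: ifP => _ //; rewrite -setC0 -setTD; exact: GC.
- split=> /=.
  + by split; [exact: abs_coord_norm|rewrite !ltr0n].
  + split=> [x|]; last by rewrite grad_sqr_coord scaler0.
    exact: ex_diff.
  + move=> x; rewrite subr0 opFbar_coin_model sub0r grad_sqr_coord.
    by rewrite /dotp big_ord1 !mxE; lra.
  (* For M = x^2 the smoothness inequality with L_s = 2 is an equality. *)
  + move=> x y; rewrite grad_sqr_coord /dotp big_ord1 !mxE real_normK ?num_real//.
    nra.
  + by move=> x; rewrite !mul1r real_normK ?num_real.
- split=> //=.
  + by split=> // x; rewrite mul1r.
  + rewrite !ge_max; apply/and4P; split.
    * rewrite /constC1 /constC1' /cA13 /cB123 /= mxE normr0 minxx.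
      rewrite !expr1n; lra.
    * lra.
    * rewrite !expr1n; lra.
    * lra.
Qed.

(** * Growth along a run of heads *)

Lemma expR_le1D2x (R : realType) (t : R) : 0 <= t -> t <= 2^-1 ->
  expR t <= 1 + 2 * t.
Proof.
move=> t0 t1; have := expR_ge1Dx (- t); rewrite expRN => H.
have e0 := expR_gt0 t.
have : (1 - t) * expR t <= 1.
  by rewrite -ler_pdivlMr// div1r.
nra.
Qed.

(** The iterate x_k takes finitely many values, one for each outcome of the first
    k flips; this is why Q may be an arbitrary set. *)
Lemma measurable_iterate (R : realType) (z h : R) (k : nat) (Q : set 'rV[R]_1) :
  measurable [set w | Q (@iterate R (coin_model R h) z k w)].
Proof.
elim: k Q => [|k IH] Q /=.
  by have [q|q] := pselect (Q (const_mx 1));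
    [rewrite (_ : [set w | _] = setT); first exact: measurableT |
     rewrite (_ : [set w | _] = set0); first exact: measurable0];
    apply/seteqP; split.
pose a := stepsize (coin_model R h) z k.
pose next b (x : 'rV[R]_1) := x + a *: (signed_double x b + 0 - x).
rewrite (_ : [set w | _] = \bigcup_(b in [set: bool])
   (flip k @^-1` [set b] `&`
    [set w | (next b @^-1` Q) (@iterate R (coin_model R h) z k w)])).
  apply: fin_bigcup_measurable => // b _; apply: measurableI; last exact: IH.
  exact: measurable_flip.
apply/seteqP; split=> w /=; first by move=> q; exists (flip k w).
by move=> [b _ [<-]].
Qed.

(** On a run of heads x_(j+1) = (1 + alpha_j) x_j, and alpha_j >= (k + h)^-z for
    j <= k. Since 1 + a >= exp(a / 2) for a in [0, 1], squaring cancels the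
    factor 1/2. *)
Lemma iterate_heads_ge (R : realType) (z h : R) (k : nat) (w : R) :
  0 < z -> 1 <= h -> (forall j, (j < k)%N -> flip j w = true) ->
  expR (k%:R / (k%:R + h) `^ z) <=
    `|@iterate R (coin_model R h) z k w 0 0| ^+ 2.
Proof.
move=> z0 h1 heads.
have kh1 : 1 <= k%:R + h by rewrite (le_trans h1)// lerDr.
set a := ((k%:R + h) `^ z)^-1.
have p1 : 1 <= (k%:R + h) `^ z.
  by rewrite -[leLHS](powRr0 (k%:R + h)) ler_powR// ltW.
have a0 : 0 < a by rewrite invr_gt0 (lt_le_trans ltr01).
have a1 : a <= 1 by rewrite invf_le1// (lt_le_trans ltr01).
have step j : (j <= k)%N ->
    (1 + a) ^+ j <= @iterate R (coin_model R h) z j w 0 0.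
  elim: j => [|j IH] jk /=; first by rewrite expr0 mxE.
  rewrite (heads _ jk) /signed_double !mxE.
  have := IH (ltnW jk); set x := iterate _ _ _ _ _ => xj.
  set s := stepsize _ _ _.
  have as_ : a <= s.
    rewrite /s /stepsize /= mul1r lef_pV2 ?posrE ?powR_gt0//.
    - rewrite ge0_ler_powR ?nnegrE ?(ltW z0)//; first by rewrite addr_ge0// (le_trans ler01).
        by rewrite (le_trans ler01).
      by rewrite lerD2r ler_nat ltnW.
    - by rewrite (lt_le_trans ltr01).
    - by rewrite (lt_le_trans ltr01)// (le_trans h1)// lerDr.
  have -> : x + s * (2 * x + 0 - x) = x * (1 + s) by ring.
  have a10 : 0 <= 1 + a by lra.
  by rewrite exprSr ler_pM ?exprn_ge0 ?lerD2l.
have xk := step k (leqnn k).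
have pos : 0 <= (1 + a) ^+ k by rewrite exprn_ge0// addr_ge0// ltW.
rewrite ger0_norm; last exact: le_trans xk.
have half : expR (a / 2) <= 1 + a.
  have := @expR_le1D2x R (a / 2); rewrite mulrCA mulfV// mulr1; apply; lra.
have -> : expR (k%:R * a) = (expR (a / 2) ^+ k) ^+ 2.
  by rewrite -!expRM_natl; congr expR; field.
rewrite ler_pXn2r ?nnegrE ?exprn_ge0 ?expR_ge0//; last exact: le_trans xk.
apply: le_trans xk; apply: lerXn2r => //; rewrite nnegrE ?expR_ge0//; lra.
Qed.

(** * Consequences for tail bounds *)

Definition tail_bound {R : realType} (m : sa_recursion R) (z : R) (g : R -> R) :=
  forall (delta : R) (k : nat), 0 < delta -> delta < 1 ->
    ((1 - delta)%:E <= Pr m [set w |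
      ((normc (iterate z k w - xstar m)) ^+ 2
         <= g delta / (k%:R + hshift m) `^ z)%R])%E.

(** If g were smaller, the bound would fail on the whole run of k heads, which is
    twice as likely as the allowed failure probability 2^-(k+1). *)
Lemma tail_bound_ge (R : realType) (z h : R) (g : R -> R) (k : nat) :
  0 < z -> 1 <= h -> tail_bound (coin_model R h) z g ->
  expR (k%:R / (k%:R + h) `^ z) <= g (2 ^- k.+1).
Proof.
move=> z0 h1 /(_ (2 ^- k.+1) k) tail.
have d0 : 0 < (2 : R) ^- k.+1 by rewrite invr_gt0 exprn_gt0.
have d1 : (2 : R) ^- k.+1 < 1.
  by rewrite invf_lt1 ?exprn_gt0// exprn_egt1// ltr1n.
move: tail => /(_ d0 d1); set G := [set w | _] => tail.
rewrite leNgt; apply/negP => gsmall.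
pose H : set R := [set w | forall j, (j < k)%N -> flip j w = true].
have mH : measurable H.
  rewrite (_ : H = \bigcap_(j in [set j | (j < k)%N]) (flip j @^-1` [set true])).
    by apply: bigcap_measurableType => j _; exact: measurable_flip.
  by [].
have GH : G `<=` ~` H.
  move=> w /= Gw Hw; have := iterate_heads_ge R z h k w z0 h1 Hw.
  move: Gw; rewrite /G /= subr0; set X := _ ^+ 2 => Gw Xw.
  have kh1 : 1 <= k%:R + h by rewrite (le_trans h1)// lerDr.
  have p1 : 1 <= (k%:R + h) `^ z.
    by rewrite -[leLHS](powRr0 (k%:R + h)) ler_powR// ltW.
  move: Gw; rewrite ler_pdivlMr ?(lt_le_trans ltr01)// => Gw.
  have : X <= X * (k%:R + h) `^ z by rewrite ler_peMr// sqr_ge0.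
  by move=> XX; have := lt_le_trans gsmall (le_trans Xw (le_trans XX Gw));
    rewrite ltxx.
have mG : measurable G.
  exact: (measurable_iterate R z h k
    [set x | `|(x - 0 : 'rV[R]_1) 0 0| ^+ 2 <= g (2 ^- k.+1) / (k%:R + h) `^ z]). 
have : ((1 - 2 ^- k.+1)%:E <= coin R (~` H))%E.
  by apply: (le_trans tail); apply: (@le_measure _ _ _ (coin R)); rewrite ?inE//; exact: measurableC.
have PH : coin R H = (2 ^- k)%:E by exact: (coin_flips (fun=> true)).
rewrite probability_setC// [X in (_ - X)%E]PH -EFinB lee_fin.
rewrite lerD2l lerN2 leNgt => /negP; apply.
by rewrite ltf_pV2 ?posrE ?exprn_gt0// ltr_eXn2l// ltr1n.
Qed.

(** Both a and b are absorbed by y^(p-q), which is unbounded; the threshold Y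
    solves y^(p-q) = 2(|a| + |b|) + 1. *)
Lemma powR_dominates (R : realType) (p q a b : R) : 0 <= q -> q < p ->
  exists Y, forall y, Y <= y -> 1 <= y -> a + b * y `^ q < y `^ p / 2.
Proof.
move=> q0 qp; set C := 2 * (`|a| + `|b|) + 1.
have C0 : 0 < C by rewrite ltr_wpDl// mulr_ge0// addr_ge0.
exists (C `^ (p - q)^-1) => y yC y1.
have y0 : 0 < y by rewrite (lt_le_trans ltr01).
have pq0 : 0 < p - q by rewrite subr_gt0.
have Cy : C <= y `^ (p - q).
  have -> : C = (C `^ (p - q)^-1) `^ (p - q).
    by rewrite -powRrM mulVf ?lt0r_neq0// powRr1// ltW.
  by rewrite ge0_ler_powR ?nnegrE ?powR_ge0// ltW.
have yq : 1 <= y `^ q by rewrite -[leLHS](powRr0 y) ler_powR.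
have -> : y `^ p = y `^ (p - q) * y `^ q.
  by rewrite -powRD ?subrK// (gt_eqF y0) implybT.
have ha := ler_norm a; have hb := ler_norm b.
have na := normr_ge0 a; have nb := normr_ge0 b.
have : C * y `^ q <= y `^ (p - q) * y `^ q by rewrite ler_pM2r ?powR_gt0.
rewrite /C; nra.
Qed.

(** The variable y = 2k is convenient because k + h <= 2k for large k, and then
    k / (k + h)^z >= k / (2k)^z = y^(1-z) / 2, the form that [powR_dominates]
    beats. The same y bounds log(1/delta) from above when delta = 2^-(k+1). *)
Lemma no_subexponential_tail (R : realType) (z h a b q N : R) (g : R -> R) :
  0 < z -> 1 <= h -> 0 <= q -> q < 1 - z ->
  (forall k : nat, N <= k%:R -> 1 <= k%:R :> R ->
    g (2 ^- k.+1) <= expR (a + b * (2 * k%:R) `^ q)) ->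
  ~ tail_bound (coin_model R h) z g.
Proof.
move=> z0 h1 q0 qz small tail.
have [Y YP] := @powR_dominates R (1 - z) q a b q0 qz.
pose k := (Num.truncn (`|N| + `|Y| + h)).+1.
have kbig : `|N| + `|Y| + h < k%:R by exact: truncnS_gt.
have nN := normr_ge0 N; have nY := normr_ge0 Y.
have hN := ler_norm N; have hY := ler_norm Y.
have k1 : 1 <= k%:R :> R by lra.
have := @tail_bound_ge R z h g k z0 h1 tail.
move=> /le_trans/(_ (small k ltac:(lra) k1)); rewrite ler_expR leNgt => /negP.
apply; apply: lt_trans (YP (2 * k%:R) ltac:(lra) ltac:(lra)) _.
have y0 : 0 < 2 * k%:R :> R by lra.
have kh0 : 0 < k%:R + h by lra.
rewrite powRB ?(gt_eqF y0) ?implybT// powRr1 ?ltW//.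
rewrite mulrAC [2 * k%:R]mulrC mulfK//.
rewrite ltr_pM2l ?(lt_le_trans ltr01 k1)// ltf_pV2 ?posrE ?powR_gt0 1?mulrC//.
by rewrite gt0_ltr_powR// ?nnegrE ?ltW//; lra.
Qed.

Lemma ln2_ge_half (R : realType) : 2^-1 <= ln (2 : R).
Proof.
rewrite -[leLHS]expRK ler_ln ?posrE ?expR_gt0//.
by apply: le_trans (@expR_le1D2x R _ _ _) _; lra.
Qed.

Lemma ln2_le1 (R : realType) : ln (2 : R) <= 1.
Proof.
rewrite -[leRHS]expRK ler_ln ?posrE ?expR_gt0//.
by apply: le_trans (expR_ge1Dx 1); lra.
Qed.

(** The truncation at 0 makes the bound valid for negative exponents, for which
    powR is decreasing in its base. *)
Lemma powR_le_max0 (R : realType) (l y beta : R) : 1 <= l -> l <= y ->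
  l `^ beta <= y `^ (Num.max beta 0).
Proof.
move=> l1 ly; apply: (@le_trans _ _ (l `^ (Num.max beta 0))).
  by rewrite ler_powR// le_max lexx.
by rewrite ge0_ler_powR ?nnegrE ?le_max ?lexx ?orbT//; lra.
Qed.

(** * The two impossibility statements *)

Theorem theorem2p3 (R : realType) (z : R) (z_gt0 : 0 < z) (z_lt1 : z < 1) :
  (exists m : sa_recursion R,
    [/\ sa_setting m, sa_assumptions z m
      & forall beta : R, beta < 2 - z ->
        ~ exists K1 K2 : R, [/\ 0 < K1, 0 < K2
          & forall (delta : R) (k : nat), 0 < delta -> delta < 1 ->
            ((1 - delta)%:E <=
             Pr m [set w | ((normc (iterate z k w - xstar m)) ^+ 2 <=
               K1 * (ln (K2 / delta)) `^ beta
               / (k%:R + hshift m) `^ z)%R])%E]])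
  /\
  (exists m : sa_recursion R,
    [/\ sa_setting m, sa_assumptions z m
      & forall beta : R, beta < 1 - z ->
        ~ exists K1 K2 : R, [/\ 0 < K1, 0 < K2
          & forall (delta : R) (k : nat), 0 < delta -> delta < 1 ->
            ((1 - delta)%:E <=
             Pr m [set w | ((normc (iterate z k w - xstar m)) ^+ 2 <=
               K1 * expR (K2 * (ln (1 / delta)) `^ beta)
               / (k%:R + hshift m) `^ z)%R])%E]]).
Proof.
pose h : R := (4 * z / (1 * 2)) `^ (1 / (1 - z)) + 360.
have h360 : 360 <= h by rewrite lerDr powR_ge0.
have h1 : 1 <= h by lra.
have set_m : sa_setting (coin_model R h) by apply: setting_coin_model; lra.
have ass_m : sa_assumptions z (coin_model R h).
  by apply: assumptions_coin_model => //; rewrite lerDl.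
have half := ln2_ge_half R; have one := ln2_le1 R.
split; exists (coin_model R h); split=> //.
- move=> beta _ [K1 [K2 [K10 K20]]].
  (* A power y^q of the logarithm equals exp(q ln y), and ln y <= y^p / p for
     any p > 0; halving 1 - z leaves p strictly below it. *)
  pose p := (1 - z) / 2; have p0 : 0 < p by rewrite /p; lra.
  pose q := Num.max beta 0.
  have q0 : 0 <= q by rewrite le_max lexx orbT.
  apply: (@no_subexponential_tail R z h (ln K1) (q / p) p (2 * `|ln K2| + 1)
    (fun delta => K1 * ln (K2 / delta) `^ beta) z_gt0 h1).
  + exact: ltW.
  + by rewrite /p; lra.
  + move=> k kN k1 /=.
    have n0 := normr_ge0 (ln K2); have n1 := ler_norm (ln K2).
    have n2 := ler_norm (- ln K2); rewrite normrN in n2.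
    have k0 : 0 <= k%:R :> R by [].
    have lo := ler_wpM2l k0 half; have hi := ler_wpM2l k0 one.
    rewrite expRD lnK ?posrE// ler_pM2l//.
    have y0 : 0 < 2 * k%:R :> R by lra.
    apply: (@le_trans _ _ ((2 * k%:R) `^ q)).
      rewrite invrK lnM ?posrE ?exprn_gt0// lnXn// mulrSr -[ln 2 *+ k]mulr_natl.
      apply: powR_le_max0; lra.
    rewrite -[_ `^ q]lnK ?posrE ?powR_gt0// ler_expR ln_powR.
    rewrite -mulrA ler_wpM2l// ler_pdivlMl// -ln_powR.
    have pos : 0 < (2 * k%:R) `^ p :> R by rewrite powR_gt0.
    by have := expR_ge1Dx (ln ((2 * k%:R) `^ p)); rewrite lnK ?posrE//; lra.
- move=> beta beta_lt [K1 [K2 [K10 K20]]].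
  apply: (@no_subexponential_tail R z h (ln K1) K2 (Num.max beta 0) 0
    (fun delta => K1 * expR (K2 * ln (1 / delta) `^ beta)) z_gt0 h1).
  + by rewrite le_max lexx orbT.
  + by rewrite gt_max beta_lt; lra.
  + move=> k _ k1 /=.
    have k0 : 0 <= k%:R :> R by [].
    have lo := ler_wpM2l k0 half; have hi := ler_wpM2l k0 one.
    rewrite expRD lnK ?posrE// ler_pM2l// ler_expR ler_pM2l//.
    rewrite div1r invrK lnXn// mulrSr -[ln 2 *+ k]mulr_natl.
    apply: powR_le_max0; lra.
Qed.
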